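(* Let $P$ and $Q$ be the stationary observable processes generated by exact finite-state generator $\epsilon$-machines $G_P$ and $G_Q$ over the same nonempty finite alphabet $\mathcal X$, and put $a=L_{\mathrm{tar}}(G_P)$, $b=L_{\mathrm{tar}}(G_Q)$. Suppose that, for every $0\le\ell\le a+b$, $$\{w\in\mathcal X^\ell:P_\ell(w)>0\}=\{w\in\mathcal X^\ell:Q_\ell(w)>0\}.$$ Then for every state $\sigma$ of $G_P$ there is a word $w_\sigma$ of length at most $a+b$, of positive probability (under both $P$ and $Q$), that synchronizes $G_P$ to $\sigma$ and simultaneously synchronizes $G_Q$ to some state. Symmetrically, for every state $\tau$ of $G_Q$ there is a word of length at most $a+b$, of positive probability (under both $P$ and $Q$), that synchronizes $G_Q$ to $\tau$ and simultaneously synchronizes $G_P$ to some state.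
   Context: Words. $\mathcal X$ is a nonempty finite alphabet, $\mathcal X^m$ the words of length $m$, $\mathcal X^*$ all finite words, $\lambda$ the empty word; $X_i^j=(X_i,\dots,X_j)$. Generator. A finite-state generator $\epsilon$-machine over $\mathcal X$ is $G=(\mathcal S,\pi,\delta,\{e_\sigma\}_{\sigma\in\mathcal S})$ where: (1) $\mathcal S$ is a nonempty finite set of states and each $e_\sigma$ is a probability mass function on $\mathcal X$; (2) a pair $(\sigma,x)$ is admissible when $e_\sigma(x)>0$, and a successor $\delta(\sigma,x)\in\mathcal S$ is defined exactly on admissible pairs; (3) the directed graph of positive-probability labeled transitions $\sigma\to\delta(\sigma,x)$ is strongly connected; (4) for $\sigma\neq\tau$ there is a word $w\in\mathcal X^*$ with $p_\sigma(w)\neq p_\tau(w)$, where $p_\sigma(w)=P(X_1^{|w|}=w\mid S_0=\sigma)$ (so $p_\sigma(\lambda)=1$); (5) $\pi$ is the unique probability vector with $\pi T=\pi$, where $T_{\sigma\tau}=\sum_{x:\,e_\sigma(x)>0,\ \delta(\sigma,x)=\tau}e_\sigma(x)$. The dynamics are $P(X_{t+1}=x,S_{t+1}=\delta(\sigma,x)\mid S_t=\sigma)=e_\sigma(x)$ for admissible $(\sigma,x)$, and the process generated by $G$ is the observable process $(X_t)_{t\in\mathbb Z}$ of the stationary joint law with $S_0\sim\pi$. Block laws. For a stationary process $P$, $P_n(w)=P(X_1^n=w)$ for $w\in\mathcal X^n$, $P_0(\lambda)=1$. Synchronization. A positive-probability word $w\in\mathcal X^m$, $m\ge0$, synchronizes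 to $\sigma$ if $P(S_m=\sigma\mid X_1^m=w)=1$ (conditioning on $\lambda$ is trivial, so $\lambda$ synchronizes iff the generator has one state). $G$ is exact if it has a finite positive-probability synchronizing word. The target synchronization radius is $L_{\mathrm{tar}}(G)=\max_{\sigma\in\mathcal S}\inf\{|w|: w\text{ synchronizes to }\sigma\}$ ($\inf\emptyset=\infty$), with $L_{\mathrm{tar}}(G)=0$ for a one-state generator. *)

(* Defs.v *)
From mathcomp Require Import all_boot all_order all_algebra.
From mathcomp Require Import boolp classical_sets reals constructive_ereal ereal.

Set Implicit Arguments.
Unset Strict Implicit.
Unset Printing Implicit Defensive.

Import Order.TTheory GRing.Theory Num.Theory.
Local Open Scope ring_scope.

Section Machine.
Variables (R : realType) (X : finType).

Record machine := Machine {
  state : finType;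
  emit : state -> X -> R;
  succ : state -> X -> option state;
  stat : state -> R
}.

Definition is_pmf (T : finType) (f : T -> R) : Prop :=
  (forall x, 0 <= f x) /\ \sum_x f x = 1.

Variable G : machine.
Local Notation S := (state G).

(* An outcome [(s0, [:: (x1, s1); ...; (xn, sn)])] of
   (S_0, X_1, S_1, ..., X_n, S_n). *)
Definition window (n : nat) : finType := (S * n.-tuple (X * S))%type.

Definition step_prob (s : S) (x : X) (t : S) : R :=
  if succ s x == Some t then emit s x else 0.

Fixpoint path_prob (s : S) (p : seq (X * S)) : R :=
  if p is (x, t) :: p' then step_prob s x t * path_prob t p' else 1.

(* Probability of an event about (S_0, X_1, S_1, ..., X_n, S_n) under the joint
   law with S_0 ~ stat. When stat is stationary these laws are consistent in n
   and shift invariant: they are the finite-dimensional laws of the two-sided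
   stationary process. *)
Definition Pr (n : nat) (A : pred (window n)) : R :=
  \sum_(u | A u) stat u.1 * path_prob u.1 u.2.

Definition condPr (n : nat) (A B : pred (window n)) : R :=
  Pr (predI A B) / Pr B.

Definition init_is (n : nat) (s : S) : pred (window n) := fun u => u.1 == s.

Definition last_is (n : nat) (s : S) : pred (window n) :=
  fun u => last u.1 (unzip2 u.2) == s.

Definition obs_is (n : nat) (w : seq X) : pred (window n) :=
  fun u => unzip1 u.2 == w.

Definition block_law (w : seq X) : R := Pr (@obs_is (size w) w).

(* p_s(w) = P(X_1^n = w | S_0 = s), n = size w. *)
Definition state_law (s : S) (w : seq X) : R :=
  condPr (@obs_is (size w) w) (@init_is (size w) s).

Definition transition (s t : S) : R :=
  \sum_(x | (0 < emit s x) && (succ s x == Some t)) emit s x.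

Definition edge : rel S :=
  fun s t => [exists x, (0 < emit s x) && (succ s x == Some t)].

Definition is_stationary (mu : S -> R) : Prop :=
  is_pmf mu /\ forall t, \sum_s mu s * transition s t = mu t.

Record is_generator : Prop := IsGenerator {
  state_nonempty : (0 < #|S|)%N;
  emit_pmf : forall s : S, is_pmf (emit s);
  succ_admissible : forall (s : S) (x : X), isSome (succ s x) = (0 < emit s x);
  strongly_connected : forall s t : S, connect edge s t;
  states_distinct : forall s t : S, s <> t ->
    exists w : seq X, state_law s w <> state_law t w;
  stat_stationary : is_stationary (@stat G);
  stat_unique : forall mu, is_stationary mu -> mu =1 @stat G
}.

Definition synchronizes (w : seq X) (s : S) : Prop :=
  0 < block_law w /\
  condPr (@last_is (size w) s) (@obs_is (size w) w) = 1.

Definition exact : Prop := exists (w : seq X) (s : S), synchronizes w s.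

Definition len (w : seq X) : \bar R := ((size w)%:R)%:E.

(* The infimum over the empty set is +oo. On a one-state generator the empty
   word synchronizes, so the value is 0 there. *)
Definition Ltar : \bar R :=
  \big[Order.max/0%E]_(s : S)
    ereal_inf [set len w | w in [set w | synchronizes w s]]%classic.

End Machine.

Arguments len R {X} w.

(* Main.v *)
(** If [w] synchronizes [GP] to [s], then [w] has positive probability under [Q],
    so it can be emitted from some state [t] of [GQ]. Prefix a shortest word [v]
    synchronizing [GQ] to [t]: the word [vw] has positive probability under [Q],
    hence under [P] because its length is at most [a + b]. It synchronizes [GQ]
    to the successor of [t] along [w] because successors are deterministic, and
    [GP] to [s] because it ends with [w] and the support of the stationary law
    is closed under transitions. *)
Require Import Defs.
From mathcomp Require Import all_boot all_order all_algebra.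
From mathcomp Require Import boolp reals constructive_ereal ereal.
Import Order.TTheory GRing.Theory Num.Theory.
Local Open Scope ring_scope.

Section Runs.
Context {R : realType} {X : finType} {G : machine R X}.
Context (G_gen : is_generator G).
Implicit Types (s t : state G) (v w : seq X).

(** Successors are deterministic, so a start state and a word fix the whole state path. Positivity
    of any event below thus reduces to this partial function; [None] means that the word cannot be
    emitted from [s]. *)
Fixpoint run s w : option (state G) :=
  if w is x :: w' then obind (run^~ w') (succ s x) else Some s.

Lemma run_cat s v w : run s (v ++ w) = obind (run^~ w) (run s v).
Proof. by elim: v s => //= x v IH s; case: (succ s x) => [t|] //=. Qed.

Lemma step_prob_ge0 s x t : 0 <= step_prob s x t.
Proof.
by rewrite /step_prob; case: ifP => // _; have [+ _] := emit_pmf G_gen s; apply.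
Qed.

Lemma step_prob_gt0 s x t : (0 < step_prob s x t) = (succ s x == Some t).
Proof.
rewrite /step_prob; case: ifP => [/eqP sx|]; last by rewrite ltxx.
by rewrite -(succ_admissible G_gen) sx.
Qed.

Lemma path_prob_ge0 s (p : seq (X * state G)) : 0 <= path_prob s p.
Proof.
by elim: p s => [|[x t] p IH] s //=; rewrite ?ler01 ?mulr_ge0 ?step_prob_ge0.
Qed.

Lemma path_prob_gt0_run s (p : seq (X * state G)) :
  0 < path_prob s p -> run s (unzip1 p) = Some (last s (unzip2 p)).
Proof.
elim: p s => [|[x t] p IH] s //=.
rewrite lt0r mulf_eq0 negb_or => /andP[/andP[sx_neq0 p_neq0] _].
have /eqP-> : succ s x == Some t by rewrite -step_prob_gt0 lt0r sx_neq0 step_prob_ge0.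
by apply: IH; rewrite lt0r p_neq0 path_prob_ge0.
Qed.

Lemma run_path_prob_gt0 s w t : run s w = Some t ->
  exists p : seq (X * state G),
    [/\ unzip1 p = w, last s (unzip2 p) = t & 0 < path_prob s p].
Proof.
elim: w s => [|x w IH] s /=; first by move=> [<-]; exists [::]; rewrite /= ltr01.
case sx: (succ s x) => [s'|] //= /IH[p [pw pt p_gt0]].
exists ((x, s') :: p); rewrite /= pw pt; split=> //.
by rewrite mulr_gt0 // step_prob_gt0 sx.
Qed.

Lemma stat_ge0 s : 0 <= stat s.
Proof. by have [[+ _] _] := stat_stationary G_gen; apply. Qed.

Lemma weight_ge0 n (u : window G n) : 0 <= stat u.1 * path_prob u.1 u.2.
Proof. by rewrite mulr_ge0 ?stat_ge0 ?path_prob_ge0. Qed.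

Lemma weight_gt0 n (u : window G n) :
  (0 < stat u.1 * path_prob u.1 u.2) = (0 < stat u.1) && (0 < path_prob u.1 u.2).
Proof.
by rewrite !lt0r weight_ge0 stat_ge0 path_prob_ge0 !andbT mulf_eq0 negb_or.
Qed.

Lemma Pr_ge0 n (A : pred (window G n)) : 0 <= Pr A.
Proof. by apply: sumr_ge0 => u _; apply: weight_ge0. Qed.

Lemma Pr_gt0P n (A : pred (window G n)) :
  0 < Pr A <-> exists u, [/\ A u, 0 < stat u.1 & 0 < path_prob u.1 u.2].
Proof.
split=> [PrA|[u [Au u1 u2]]].
  have /eqP/psumr_neq0P[u _|u /andP[Au]] : Pr A != 0 by rewrite gt_eqF.
    exact: weight_ge0.
  by rewrite weight_gt0 => /andP[u1 u2]; exists u.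
rewrite /Pr (bigD1 u) //= ltr_wpDr ?sumr_ge0 ?mulr_gt0 // => v _.
exact: weight_ge0.
Qed.

(** The end condition [B] is left free for two uses: [xpredT] gives positivity of a block law, and
    the complement of one state gives failure of synchronization. *)
Lemma Pr_obs_gt0P w (B : pred (state G)) :
  0 < Pr (predI (fun u : window G (size w) => B (last u.1 (unzip2 u.2)))
                (@obs_is _ _ G (size w) w)) <->
  exists s t, [/\ 0 < stat s, run s w = Some t & B t].
Proof.
split=> [/Pr_gt0P[[s p] [/= /andP[Bt /eqP pw] s_gt0 /path_prob_gt0_run]]|].
  by rewrite pw => st; exists s, (last s (unzip2 p)).
move=> [s [t [s_gt0 /run_path_prob_gt0[p [pw pt p_gt0]] Bt]]].
have p_size : size p == size w by rewrite -pw size_map.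
apply/Pr_gt0P; exists (s, Tuple p_size); split=> //=.
by rewrite pt Bt /obs_is /= pw eqxx.
Qed.

Lemma block_law_gt0P w :
  0 < block_law G w <-> exists s t, 0 < stat s /\ run s w = Some t.
Proof.
apply: (iff_trans (Pr_obs_gt0P w xpredT)).
by split=> [[s [t []]]|[s [t []]]]; exists s, t.
Qed.

(** Conditional probability one leaves no mass on the other end states; since all weights are
    nonnegative, this excludes every run from the support of [stat] that ends elsewhere. *)
Lemma synchronizesP w t :
  synchronizes w t <->
  0 < block_law G w /\
  forall s t', 0 < stat s -> run s w = Some t' -> t' = t.
Proof.
rewrite /synchronizes /condPr.
set A := last_is _; set B := obs_is w.
have PrB : block_law G w = Pr (predI A B) + Pr (predI (predC A) B).
  rewrite /block_law /Pr (bigID A) /=; congr (_ + _).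
    by apply: eq_bigl => u; rewrite /= andbC.
  by apply: eq_bigl => u; rewrite /= andbC.
split=> -[w_gt0 wt]; split=> //.
- move=> s t' s_gt0 st'; apply/eqP; apply: contraT => t'_neq.
  have : 0 < Pr (predI (predC A) B).
    by apply/(Pr_obs_gt0P w (fun t' => t' != t)); exists s, t'.
  (* Clearing the denominator gives the event [A] all of the mass of [B], so the complementary
     summand in [PrB] is zero. *)
  move: wt => /(congr1 ( *%R^~ (Pr B))).
  rewrite divfK ?mul1r ?gt_eqF // => PrAB.
  move: PrB; rewrite -[block_law G w]/(Pr B) PrAB -[LHS]addr0 => /addrI <-.
  by rewrite ltxx.
- have PrCAB : Pr (predI (predC A) B) = 0.
    apply/eqP; rewrite eq_le Pr_ge0 andbT leNgt; apply/negP.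
    move=> /(Pr_obs_gt0P w (fun t' => t' != t))[s [t' [s_gt0 st']]].
    by rewrite (wt _ _ s_gt0 st') eqxx.
  move: PrB; rewrite PrCAB addr0 -[block_law G w]/(Pr B) => <-.
  by rewrite divff // gt_eqF.
Qed.

(** In the stationarity equation at [t], the contribution of [s] through the letter [x] is positive
    and all others are nonnegative. *)
Lemma stat_succ_gt0 s x t : 0 < stat s -> succ s x = Some t -> 0 < stat t.
Proof.
move=> s_gt0 sx; have [_ /(_ t) <-] := stat_stationary G_gen.
have sx_gt0 : 0 < emit s x by rewrite -(succ_admissible G_gen) sx.
have T_ge0 s' : 0 <= transition s' t by apply: sumr_ge0 => y /andP[/ltW].
rewrite (bigD1 s) //= ltr_wpDr ?sumr_ge0 //.
  by move=> s' _; rewrite mulr_ge0 ?stat_ge0.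
rewrite mulr_gt0 // /transition (bigD1 x) /= ?sx_gt0 ?sx ?eqxx //.
by rewrite ltr_wpDr ?sumr_ge0 // => y /andP[/andP[/ltW]].
Qed.

Lemma stat_run_gt0 s w t : 0 < stat s -> run s w = Some t -> 0 < stat t.
Proof.
elim: w s => [|x w IH] s s_gt0 /=; first by move=> [<-].
by case sx: (succ s x) => [s'|] //=; apply: IH; apply: stat_succ_gt0 sx.
Qed.

(** After [v] the state is still in the support of [stat], where [w] forces [t]. Positivity is
    assumed because a prefix may make the word impossible. *)
Lemma synchronizes_catl v w t :
  0 < block_law G (v ++ w) -> synchronizes w t -> synchronizes (v ++ w) t.
Proof.
move=> vw_gt0 /synchronizesP[_ wt]; apply/synchronizesP; split=> // s t' s_gt0.
rewrite run_cat; case sv: (run s v) => [s'|] //=.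
by apply: wt; apply: stat_run_gt0 sv.
Qed.

(** Here positivity comes for free: [v] leads to [s], from which [w] can be emitted. *)
Lemma synchronizes_catr v w s t :
  synchronizes v s -> run s w = Some t -> synchronizes (v ++ w) t.
Proof.
move=> /synchronizesP[/block_law_gt0P[r [s' [r_gt0 rv]]] vs] sw.
apply/synchronizesP; split.
  apply/block_law_gt0P; exists r, t; split=> //.
  by rewrite run_cat rv /= (vs _ _ r_gt0 rv).
move=> r' t' r'_gt0; rewrite run_cat; case r'v: (run r' v) => [s''|] //=.
by rewrite (vs _ _ r'_gt0 r'v) sw => -[].
Qed.

Lemma exists_run s t : exists w, run s w = Some t.
Proof.
have /connectP[p] := strongly_connected G_gen s t.
elim: p s => [|s' p IH] s /=; first by move=> _ ->; exists [::].
move=> /andP[/existsP[x /andP[_ /eqP sx]] s'p] /(IH _ s'p)[w s'w].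
by exists (x :: w); rewrite /= sx.
Qed.

(** Strong connectivity extends one synchronizing word by a path from its target to [t]. *)
Lemma exact_synchronizes t : exact G -> exists w, synchronizes w t.
Proof.
move=> [v [s vs]]; have [w sw] := exists_run s t.
by exists (v ++ w); apply: synchronizes_catr sw.
Qed.

Lemma exact_short_synchronizes t :
  exact G -> exists w, synchronizes w t /\ (len R w <= Ltar G)%E.
Proof.
move=> /(exact_synchronizes t)[w0 w0t].
pose P n := `[< exists w, synchronizes w t /\ size w = n >].
have exP : exists n, P n by exists (size w0); apply/asboolP; exists w0.
(* Lengths are natural numbers, so a shortest synchronizing word exists. It attains the infimum for
   [t], one of the terms of the maximum [Ltar]. *)
case: (ex_minnP exP) => _ /asboolP[w [wt <-]] w_min.
exists w; split=> //; apply: le_trans (le_bigmax _ _ t).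
apply/ereal_infP => _ [v /= vt <-]; rewrite lee_fin ler_nat.
by apply: w_min; apply/asboolP; exists v.
Qed.

End Runs.

Lemma common_synchronizing_word (R : realType) (X : finType) (GP GQ : machine R X)
    (GP_gen : is_generator GP) (GQ_gen : is_generator GQ)
    (GP_exact : exact GP) (GQ_exact : exact GQ)
    (same_support : forall w : seq X, (len R w <= Ltar GP + Ltar GQ)%E ->
      (0 < block_law GP w) = (0 < block_law GQ w)) (s : state GP) :
  exists w : seq X,
    [/\ (len R w <= Ltar GP + Ltar GQ)%E,
        0 < block_law GP w, 0 < block_law GQ w,
        synchronizes w s
      & exists t : state GQ, synchronizes w t].
Proof.
have [w [ws w_le]] := exact_short_synchronizes GP_gen s GP_exact.
(* The maximum starts from 0. This puts [w] itself, of length at most [Ltar GP], in the range where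
   the supports agree. *)
have LQ_ge0 : (0 <= Ltar GQ)%E by apply: bigmax_ge_id.
have /block_law_gt0P : 0 < block_law GQ w.
  rewrite -same_support; last by rewrite -[len R w]adde0 leeD.
  by case: ws.
move=> /(_ GQ_gen)[t [t' [_ tw]]].
have [v [vt v_le]] := exact_short_synchronizes GQ_gen t GQ_exact.
have vw_le : (len R (v ++ w) <= Ltar GP + Ltar GQ)%E.
  by rewrite /len size_cat addnC natrD EFinD leeD.
have vwt := synchronizes_catr GQ_gen _ _ _ _ vt tw.
have vwQ : 0 < block_law GQ (v ++ w) by case: vwt.
have vwP : 0 < block_law GP (v ++ w) by rewrite same_support.
exists (v ++ w); split=> //; last by exists t'.
exact: synchronizes_catl.
Qed.

Theorem lemma5p1 (R : realType) (X : finType) (X_nonempty : (0 < #|X|)%N)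
    (GP GQ : machine R X)
    (GP_gen : is_generator GP) (GQ_gen : is_generator GQ)
    (GP_exact : exact GP) (GQ_exact : exact GQ)
    (same_support : forall l : nat, (l%:R%:E <= Ltar GP + Ltar GQ)%E ->
      [set w : l.-tuple X | 0 < block_law GP w]
        = [set w : l.-tuple X | 0 < block_law GQ w]) :
  (forall s : state GP, exists w : seq X,
     [/\ (len R w <= Ltar GP + Ltar GQ)%E,
         0 < block_law GP w, 0 < block_law GQ w,
         synchronizes w s
       & exists t : state GQ, synchronizes w t]) /\
  (forall t : state GQ, exists w : seq X,
     [/\ (len R w <= Ltar GP + Ltar GQ)%E,
         0 < block_law GP w, 0 < block_law GQ w,
         synchronizes w t
       & exists s : state GP, synchronizes w s]).
Proof.
(* Each word is read as a tuple of its own length. *)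
have support w : (len R w <= Ltar GP + Ltar GQ)%E ->
    (0 < block_law GP w) = (0 < block_law GQ w).
  by move=> /same_support/setP/(_ (in_tuple w)); rewrite !inE.
split=> [s|t]; first exact: common_synchronizing_word.
have [|w [w_le wQ wP wt ws]] :=
    common_synchronizing_word _ _ GQ GP GQ_gen GP_gen GQ_exact GP_exact _ t.
  by move=> w; rewrite addeC => /support.
by exists w; rewrite addeC.
Qed.
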